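(* For one VIPA of capacity $\mathrm{Cap}$ operating in elevator mode on a line $L=(v_0,\dots,v_n)$ of length $|L|$ with origin $v_0$, the online algorithm MAIN is $2\,\mathrm{Cap}\cdot|L|$-competitive with respect to minimizing the total tour length.
   Context: A request is $r_j=(t_j,x_j,y_j,z_j)$: released at time $t_j$ (and only then known to the online algorithm), with origin station $x_j$, destination station $y_j$ and $z_j$ passengers. The VIPA has capacity $\mathrm{Cap}$ and unit speed. A feasible transportation schedule is a tour starting and ending at the origin $v_0$ that carries every passenger from its origin to its destination, never serving a request before its release date; its total tour length is its length. In elevator mode the VIPA moves along the line and may change direction at any station (and may wait). Stations are ordered $v_0<v_1<\dots<v_n$ along the line. An online algorithm ALG is $c$-competitive if $ALG(\sigma)\le c\cdot OPT(\sigma)$ for every request sequence $\sigma$, where $OPT(\sigma)$ is the minimum total tour length of a feasible schedule computed with full knowledge of $\sigma$ in advance. Algorithm MAIN (''Move Away If Necessary''): the server starts at $s:=v_0$; let $\sigma'$ be the set of released but not yet served requests. While $\sigma'\ne\emptyset$: let $\sigma'_{up}$ be the requests in $\sigma'$ with $s\le x_j\le y_j$; if $\sigma'_{up}\neq\emptyset$, serve all requests (or up to $\mathrm{Cap}$ passengers) of $\sigma'_{up}$, moving away from $v_0$ to the furthest destination among them; otherwise let $\sigma'_{down}$ be the requests in $\sigma'$ with $x_j>y_j$ and serve all of them (or up to $\mathrm{Cap}$ passengers) while moving towards the origin; then update $s$ and $\sigma'$ (remove served requests, add newly released ones).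
   Formalization: Every edge of the line is assumed to have length at least 1 (for shorter edges the ratio 2 Cap |L| can fail, even drop below 1), and requests with equal origin and destination or with no passengers are excluded, since with them the claim fails or is degenerate. *)

(* Defs.v *)
From HB Require Import structures.
From mathcomp Require Import boolp classical_sets reals.
From mathcomp Require Import all_boot all_order all_algebra.

Set Implicit Arguments.
Unset Strict Implicit.
Unset Printing Implicit Defensive.

Import Order.TTheory GRing.Theory Num.Theory.
Local Open Scope ring_scope.

(* The stations v_0 < ... < v_n of the line are the ordinals 'I_n.+1, the
   origin being ord0; edge e : 'I_n joins v_e and v_(e+1) and has length
   ell e.  A competitive ratio proportional to the length of the line presumes
   a unit of length, which no edge is shorter than: 1 <= ell e. *)

Definition position (R : realType) (n : nat) (ell : 'I_n -> R)
    (i : 'I_n.+1) : R :=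
  \sum_(e < n | (e < i)%N) ell e.

Definition dist (R : realType) (n : nat) (ell : 'I_n -> R)
    (i j : 'I_n.+1) : R :=
  `|position ell i - position ell j|.

Definition line_length (R : realType) (n : nat) (ell : 'I_n -> R) : R :=
  \sum_(e < n) ell e.

Record request (R : realType) (n : nat) := Request {
  release : R;
  orig : 'I_n.+1;
  dest : 'I_n.+1;
  npass : nat
}.

(* Requests without passengers or with equal origin and destination are
   excluded: arbitrarily many of them could be served by a single visit. *)
Definition valid_request (R : realType) (n : nat) (r : request R n) : bool :=
  [&& 0 <= release r, orig r != dest r & (0 < npass r)%N].

(* The individual passengers of the sequence sigma: (j, k) is the k-th
   passenger of the j-th request. *)
Definition passenger (R : realType) (n : nat) (sigma : seq (request R n)) :=
  {j : 'I_(size sigma) & 'I_(npass (tnth (in_tuple sigma) j))}.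

Definition req (R : realType) (n : nat) (sigma : seq (request R n))
    (p : passenger sigma) : request R n :=
  tnth (in_tuple sigma) (tag p).

Definition tour_length (R : realType) (n : nat) (ell : 'I_n -> R)
    (w : seq 'I_n.+1) : R :=
  \sum_(i < (size w).-1) dist ell (nth ord0 w i) (nth ord0 w i.+1).

(* A schedule is the list of the successive stops (station, departure time)
   together with, for every passenger, the index of the stop where it boards
   and of the stop where it alights.  The vehicle drives at unit speed between
   two stops and waits at the second one until its departure from there. *)
Record schedule (R : realType) (n : nat) (sigma : seq (request R n)) :=
  Schedule {
    stops : seq ('I_n.+1 * R);
    board : passenger sigma -> nat;
    alight : passenger sigma -> nat
  }.

Definition station_at (R : realType) (n : nat) (sigma : seq (request R n))
    (S : schedule sigma) (i : nat) : 'I_n.+1 :=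
  (nth (ord0, 0) (stops S) i).1.

Definition departure (R : realType) (n : nat) (sigma : seq (request R n))
    (S : schedule sigma) (i : nat) : R :=
  (nth (ord0, 0) (stops S) i).2.

Definition feasible (R : realType) (n : nat) (ell : 'I_n -> R) (Cap : nat)
    (sigma : seq (request R n)) (S : schedule sigma) : Prop :=
  [/\ [/\ (0 < size (stops S))%N,
          station_at S 0 = ord0,
          station_at S (size (stops S)).-1 = ord0 &
          0 <= departure S 0],
      forall i : nat, (i.+1 < size (stops S))%N ->
        departure S i + dist ell (station_at S i) (station_at S i.+1)
          <= departure S i.+1,
      forall p : passenger sigma,
        [/\ (board S p < alight S p < size (stops S))%N,
            station_at S (board S p) = orig (req p),
            station_at S (alight S p) = dest (req p) &
            release (req p) <= departure S (board S p)] &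
      forall i : nat,
        (#|[set p : passenger sigma | (board S p <= i < alight S p)%N]|
           <= Cap)%N].

Definition schedule_length (R : realType) (n : nat) (ell : 'I_n -> R)
    (sigma : seq (request R n)) (S : schedule sigma) : R :=
  tour_length ell [seq st.1 | st <- stops S].

Definition OPT (R : realType) (n : nat) (ell : 'I_n -> R) (Cap : nat)
    (sigma : seq (request R n)) : R :=
  inf [set x : R | exists2 S : schedule sigma,
                     feasible ell Cap S & x = schedule_length ell S]%classic.

(* An online algorithm may leave choices open (e.g. which passengers to take
   when there are too many), so it is given by the tours ALG sigma w it can
   drive on sigma; it must drive some tour on every sequence, and each one
   has to meet the bound. *)
Definition competitive (R : realType) (n : nat) (ell : 'I_n -> R) (Cap : nat)
    (ALG : seq (request R n) -> seq 'I_n.+1 -> Prop) (c : R) : Prop :=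
  forall sigma : seq (request R n), all (@valid_request R n) sigma ->
    (exists w, ALG sigma w) /\
    (forall w, ALG sigma w -> tour_length ell w <= c * OPT ell Cap sigma).

Section Main.
Context (R : realType) (n : nat) (ell : 'I_n -> R) (Cap : nat).
Context (sigma : seq (request R n)).
Implicit Types (s h : 'I_n.+1) (t : R) (U A B : {set passenger sigma}).

(* U is the set of passengers not served yet, released or not. *)
Definition pending t U := [set p in U | release (req p) <= t].

Definition pending_up s t U :=
  [set p in pending t U | (s <= orig (req p) <= dest (req p))%N].

Definition pending_down t U :=
  [set p in pending t U | (dest (req p) < orig (req p))%N].

Definition rides_over (e : 'I_n) (p : passenger sigma) : bool :=
  (minn (orig (req p)) (dest (req p)) <= e
     < maxn (orig (req p)) (dest (req p)))%N.

(* B can be served out of A in a single sweep: at most Cap passengers are on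
   board at any time, and either everybody in A is served or the Cap seats
   are used (a seat that gets free during the sweep may be used again). *)
Definition batch A B : Prop :=
  [/\ B \subset A,
      forall e : 'I_n, (#|[set p in B | rides_over e p]| <= Cap)%N &
      B = A \/ (Cap <= #|B|)%N].

Definition furthest_dest s B : 'I_n.+1 :=
  \big[Order.max/s]_(p in B) dest (req p).

Definition furthest_orig s B : 'I_n.+1 :=
  \big[Order.max/s]_(p in B) orig (req p).

(* main_run s t U w: with the server at s at time t and the passengers of U
   still to be served, w lists the stations the server heads for until the
   end of its tour.
   - In a downward sweep the server first drives up to the furthest origin to
     be visited, if it lies beyond s, and then down to v_0.
   - When no released request is left, the server may wait at s for the next
     release or return to v_0. *)
Inductive main_run :
    'I_n.+1 -> R -> {set passenger sigma} -> seq 'I_n.+1 -> Prop :=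
| main_done t :
    main_run ord0 t set0 [::]
| main_home s t U w :
    pending t U = set0 -> s != ord0 ->
    main_run ord0 (t + dist ell s ord0) U w ->
    main_run s t U (ord0 :: w)
| main_wait s t U p w :
    pending t U = set0 ->
    p \in U -> (forall q, q \in U -> release (req p) <= release (req q)) ->
    main_run s (release (req p)) U w ->
    main_run s t U w
| main_up s t U B w :
    pending_up s t U != set0 ->
    batch (pending_up s t U) B ->
    main_run (furthest_dest s B) (t + dist ell s (furthest_dest s B))
             (U :\: B) w ->
    main_run s t U (furthest_dest s B :: w)
| main_down s t U B w :
    pending t U != set0 -> pending_up s t U = set0 ->
    batch (pending_down t U) B ->
    main_run ord0 (t + dist ell s (furthest_orig s B)
                     + dist ell (furthest_orig s B) ord0) (U :\: B) w ->
    main_run s t U [:: furthest_orig s B, ord0 & w].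

End Main.

Definition MAIN (R : realType) (n : nat) (ell : 'I_n -> R) (Cap : nat)
    (sigma : seq (request R n)) (w : seq 'I_n.+1) : Prop :=
  exists2 w' : seq 'I_n.+1,
    main_run ell Cap ord0 0 [set: passenger sigma] w' & w = ord0 :: w'.

(* Main.v *)
Require Import Defs.
From mathcomp Require Import boolp classical_sets reals.
From mathcomp Require Import all_boot all_order all_algebra.
From mathcomp Require Import lra.

Set Implicit Arguments.
Unset Strict Implicit.
Unset Printing Implicit Defensive.

Import Order.TTheory GRing.Theory Num.Theory.
Local Open Scope ring_scope.

(* Cut a tour of MAIN at its returns to v_0.  In each round the server moves up
   to some station and then back down, so a round costs at most 2|L|; and each
   round serves at least one passenger, because a downward sweep that takes
   nobody only occurs away from v_0, where the server arrived by serving an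
   upward request.  Hence MAIN costs at most 2|L| per passenger.  Conversely,
   every passenger travels a distance of at least 1 and no leg carries more
   than Cap of them, so the number of passengers is at most Cap * OPT. *)

(** * Distances on the line *)

Section Line.
Context (R : realType) (n : nat) (ell : 'I_n -> R).
Hypothesis ell_ge1 : forall e : 'I_n, 1 <= ell e.
Implicit Types i j k : 'I_n.+1.

Lemma ell_ge0 e : 0 <= ell e.
Proof. exact: le_trans ler01 (ell_ge1 e). Qed.

Lemma position0 : position ell ord0 = 0.
Proof. by rewrite /position big_pred0. Qed.

Lemma position_ge0 i : 0 <= position ell i.
Proof. by apply: sumr_ge0 => e _; exact: ell_ge0. Qed.

Lemma position_le_line i : position ell i <= line_length ell.
Proof.
rewrite /line_length (bigID (fun e : 'I_n => (e < i)%N)) /= lerDl.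
by apply: sumr_ge0 => e _; exact: ell_ge0.
Qed.

Lemma position_le i j : (i <= j)%N -> position ell i <= position ell j.
Proof.
move=> ij; rewrite /position [leRHS](bigID (fun e : 'I_n => (e < i)%N)) /=.
rewrite [X in X + _](eq_bigl (fun e : 'I_n => (e < i)%N)); last first.
  move=> e; apply/andP/idP => [[]//|ei]; split => //; exact: leq_trans ei ij.
by rewrite lerDl; apply: sumr_ge0 => e _; exact: ell_ge0.
Qed.

(** The edge leaving [i] already contributes at least 1; this is where the unit of length enters. *)
Lemma position_lt i j : (i < j)%N -> position ell i + 1 <= position ell j.
Proof.
move=> ij; have lt_in : (i < n)%N by exact: leq_trans ij (ltn_ord j).
pose e0 := Ordinal lt_in.
rewrite /position [leRHS](bigD1 e0) //= addrC lerD //.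
rewrite [leRHS](bigID (fun e : 'I_n => (e < i)%N)) /=.
rewrite [X in X + _](eq_bigl (fun e : 'I_n => (e < i)%N)); last first.
  move=> e; apply/andP/idP => [[]//|ei]; split => //.
  by rewrite (ltn_trans ei ij) -val_eqE /= neq_ltn ei.
by rewrite lerDl; apply: sumr_ge0 => e _; exact: ell_ge0.
Qed.

Lemma dist_le i j : (i <= j)%N -> dist ell i j = position ell j - position ell i.
Proof. by move=> ij; rewrite /dist distrC ger0_norm // subr_ge0 position_le. Qed.

Lemma dist_origin i : dist ell i ord0 = position ell i.
Proof. by rewrite /dist position0 subr0 ger0_norm ?position_ge0. Qed.

Lemma dist_ge0 i j : 0 <= dist ell i j.
Proof. exact: normr_ge0. Qed.

Lemma dist_ge1 i j : i != j -> 1 <= dist ell i j.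
Proof.
move=> neq_ij; have /orP[lt_ij|lt_ji] : (i < j)%N || (j < i)%N.
- by rewrite -neq_ltn.
- by rewrite dist_le 1?ltnW // lerBrDl position_lt.
- by rewrite /dist distrC -/(dist _ _ _) dist_le 1?ltnW // lerBrDl position_lt.
Qed.

Lemma dist_le_line i j : dist ell i j <= line_length ell.
Proof.
have := (position_ge0 i, position_ge0 j, position_le_line i, position_le_line j).
by move=> [[[? ?] ?] ?]; rewrite /dist ler_norml; apply/andP; split; lra.
Qed.

Lemma dist_triangle i j k : dist ell i k <= dist ell i j + dist ell j k.
Proof. exact: ler_distD. Qed.

Lemma line_length_ge0 : 0 <= line_length ell.
Proof. by apply: sumr_ge0 => e _; exact: ell_ge0. Qed.

Lemma dist_le_path (f : nat -> 'I_n.+1) a b : (a <= b)%N ->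
  dist ell (f a) (f b) <= \sum_(a <= i < b) dist ell (f i) (f i.+1).
Proof.
elim: b => [|b IHb].
  by rewrite leqn0 => /eqP->; rewrite big_geq // /dist subrr normr0.
rewrite leq_eqVlt => /predU1P[->|].
  by rewrite big_geq // /dist subrr normr0.
rewrite ltnS => ab; rewrite big_nat_recr //=.
by apply: le_trans (dist_triangle _ (f b) _) _; rewrite lerD2r IHb.
Qed.

Lemma tour_length1 i : tour_length ell [:: i] = 0.
Proof. by rewrite /tour_length big_ord0. Qed.

Lemma tour_length_cons2 i j w :
  tour_length ell [:: i, j & w] = dist ell i j + tour_length ell (j :: w).
Proof. by rewrite /tour_length /= big_ord_recl. Qed.

End Line.

(** * Number of passengers against the optimum *)

Section Passengers.
Context (R : realType) (n : nat) (ell : 'I_n -> R).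
Hypothesis ell_ge1 : forall e : 'I_n, 1 <= ell e.
Context (Cap : nat).
Hypothesis Cap_gt0 : (0 < Cap)%N.
Context (sigma : seq (request R n)).
Hypothesis sigma_valid : all (@valid_request R n) sigma.
Implicit Types (s : 'I_n.+1) (t : R) (A B U : {set passenger sigma}).
Implicit Type S : schedule sigma.

Let L := line_length ell.

Lemma valid_req (p : passenger sigma) : valid_request (req p).
Proof. exact: (all_tnthP (t := in_tuple sigma) sigma_valid). Qed.

Lemma orig_neq_dest (p : passenger sigma) : orig (req p) != dest (req p).
Proof. by have /and3P[] := valid_req p. Qed.

(** Double counting of pairs of a passenger and a leg travelled on board: summed by passengers the
    legs give at least 1 each, summed by legs each counts at most [Cap] times. *)
Lemma card_passengers_le S : feasible ell Cap S ->
  #|{: passenger sigma}|%:R <= Cap%:R * schedule_length ell S.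
Proof.
move=> [[_ _ _ _] _ serves capacity].
pose leg i := dist ell (station_at S i) (station_at S i.+1).
set m := (size (stops S)).-1.
have -> : schedule_length ell S = \sum_(i < m) leg i.
  rewrite /schedule_length /tour_length size_map; apply: eq_bigr => i _.
  have lt_i : (i.+1 < size (stops S))%N by rewrite -ltn_predRL.
  by rewrite !(nth_map (ord0, 0)) // ltnW.
have ride p : 1 <= \sum_(i < m | (board S p <= i < alight S p)%N) leg i.
  have [/andP[lt_ba lt_a] orig_p dest_p _] := serves p.
  have le_am : (alight S p <= m)%N by rewrite -ltnS prednK // (leq_trans _ lt_a).
  apply: le_trans (dist_ge1 ell_ge1 (orig_neq_dest p)) _.
  rewrite -orig_p -dest_p.
  apply: le_trans (dist_le_path _ _ (ltnW lt_ba)) _.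
  rewrite (big_nat_widen _ _ m) // big_geq_mkord /=.
  by rewrite (eq_bigl (fun i : 'I_m => (board S p <= i < alight S p)%N)) // => i;
    rewrite andbC.
have -> : #|{: passenger sigma}|%:R = \sum_(p : passenger sigma) (1 : R).
  by rewrite sumr_const.
apply: le_trans (ler_sum _ (fun p _ => ride p)) _.
rewrite (exchange_big_dep predT) //= mulr_sumr; apply: ler_sum => i _.
rewrite sumr_const -[leLHS]mulr_natl ler_wpM2r ?dist_ge0 // ler_nat.
by rewrite -cardsE; exact: capacity.
Qed.

(* Once everything is released, carry the passengers one at a time. *)
Lemma feasible_schedule_exists : exists S : schedule sigma, feasible ell Cap S.
Proof.
pose P := passenger sigma; pose m := #|{: P}|.
(* As release dates are nonnegative, their sum bounds each of them. *)
pose T : R := \sum_(p : P) release (req p).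
have rel_ge0 (p : P) : 0 <= release (req p) by have /and3P[] := valid_req p.
have T_ge0 : 0 <= T by apply: sumr_ge0.
(* The passenger of rank [r] boards at stop [2r+1] and alights at stop [2r+2]. At the last stop,
   [2m+1], no rank matches and the default [ord0] closes the tour. *)
pose st (i : nat) : 'I_n.+1 :=
  if i is j.+1 then
    if [pick p : P | enum_rank p == j./2 :> nat] is Some p then
      if odd j then dest (req p) else orig (req p)
    else ord0
  else ord0.
(* Departures are spaced by [L], which is enough time for any leg. *)
pose S := Schedule [seq (st i, T + L *+ i) | i <- iota 0 m.*2.+2]
  (fun p : P => (enum_rank p).*2.+1) (fun p : P => (enum_rank p).*2.+2).
have size_S : size (stops S) = m.*2.+2 by rewrite size_map size_iota.
have nth_S i : (i < m.*2.+2)%N ->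
    station_at S i = st i /\ departure S i = T + L *+ i.
  move=> lt_i; rewrite /station_at /departure (nth_map 0%N) ?size_iota //.
  by rewrite nth_iota.
have pick_rank (p : P) : [pick q : P | enum_rank q == enum_rank p :> nat] = Some p.
  case: pickP => [q /eqP/val_inj/enum_rank_inj -> //|/(_ p)].
  by rewrite eqxx.
have lt_rank (p : P) : ((enum_rank p).*2.+2 < m.*2.+2)%N.
  by rewrite !ltnS ltn_double.
exists S; split.
- split; rewrite ?size_S //=.
  + have [-> _] := nth_S m.*2.+1 (leqnn _); rewrite /st doubleK.
    by case: pickP => // p /eqP Ep; have := ltn_ord (enum_rank p); rewrite Ep ltnn.
  + by have [_ ->] := nth_S 0%N isT; rewrite mulr0n addr0.
- rewrite size_S => i lt_i.
  have [-> ->] := nth_S _ (ltnW lt_i); have [-> ->] := nth_S _ lt_i.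
  by rewrite mulrSr addrA lerD2l dist_le_line.
- move=> p; have [bst bdep] := nth_S _ (ltnW (lt_rank p)).
  have [ast _] := nth_S _ (lt_rank p).
  split; rewrite ?size_S ?ltnSn ?lt_rank //=.
  + by rewrite bst /st doubleK pick_rank odd_double.
  + by rewrite ast /st /= uphalf_double pick_rank odd_double.
  + rewrite bdep; apply: (@le_trans _ _ T).
      by rewrite /T (bigD1 p) //= lerDl sumr_ge0.
    by rewrite lerDl mulrn_wge0 // line_length_ge0.
(* The riding intervals are disjoint, so at most one passenger is on board. *)
- move=> i; apply: leq_trans Cap_gt0.
  apply/card_le1_eqP => p q; rewrite !inE /= => /andP[bp ap] /andP[bq aq].
  apply/enum_rank_inj/val_inj/double_inj/eqP => /=; rewrite eqn_leq.
  by have := leq_ltn_trans bp aq; have := leq_ltn_trans bq ap; rewrite !ltnS => -> ->.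
Qed.

(** A bound on all feasible lengths passes to their infimum only if some schedule is feasible: the
    infimum of the empty set is a default value. *)
Lemma card_passengers_le_OPT :
  #|{: passenger sigma}|%:R <= Cap%:R * OPT ell Cap sigma.
Proof.
rewrite mulrC -ler_pdivrMr ?ltr0n //; apply: lb_le_inf.
  have [S feasS] := feasible_schedule_exists.
  by exists (schedule_length ell S); exists S.
move=> _ [S feasS ->].
by rewrite ler_pdivrMr ?ltr0n // mulrC card_passengers_le.
Qed.

(** * Batches, and the progress made by a sweep *)

Lemma batch_neq0 A B : A != set0 -> batch Cap A B -> B != set0.
Proof.
move=> A0 [_ _ [->//|le_Cap]]; rewrite -card_gt0; exact: leq_trans le_Cap.
Qed.

Lemma card_setD_batch_lt A B U : A \subset U -> A != set0 -> batch Cap A B ->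
  (#|U :\: B| < #|U|)%N.
Proof.
move=> subA A0 batchB; have [subB _ _] := batchB.
rewrite -[ltnRHS](cardsID B U) (setIidPr (subset_trans subB subA)).
by rewrite -add1n leq_add2r card_gt0 (batch_neq0 A0 batchB).
Qed.

Lemma batch_exists A : exists B, batch Cap A B.
Proof.
have [leA|ltA] := leqP #|A| Cap.
  exists A; split; [exact: subxx| |by left].
  move=> e; apply: leq_trans leA; apply/subset_leq_card/subsetP => p.
  by rewrite inE => /andP[].
(* Any [Cap] passengers will do: even all together they overload no edge. *)
have /card_geqP[r [uniq_r size_r sub_r]] := ltnW ltA.
have card_r : #|[set p in r]| = Cap by rewrite cardsE (card_uniqP uniq_r).
exists [set p in r]; split.
- by apply/subsetP => p; rewrite inE; exact: sub_r.
- move=> e; rewrite -[leqRHS]card_r; apply/subset_leq_card/subsetP => p.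
  by rewrite inE => /andP[].
- by right; rewrite card_r.
Qed.

Lemma batch_set0 : batch Cap (set0 : {set passenger sigma}) set0.
Proof.
split; [exact: subxx| |by left].
move=> e; rewrite (_ : [set p in _ | _] = set0) ?cards0 //.
by apply/setP => p; rewrite !inE.
Qed.

Lemma pending_up_sub s t U : pending_up s t U \subset U.
Proof. by apply/subsetP => p; rewrite !inE => /andP[/andP[]]. Qed.

Lemma pending_down_sub t U : pending_down t U \subset U.
Proof. by apply/subsetP => p; rewrite !inE => /andP[/andP[]]. Qed.

(** At [ord0] no origin lies behind the server, so a pending passenger who does not go up goes
    down. *)
Lemma pending_down_neq0 t U :
  pending t U != set0 -> pending_up ord0 t U = set0 ->
  pending_down t U != set0.
Proof.
move=> /set0Pn[p pend_p] /setP/(_ p); rewrite inE pend_p inE /=.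
move=> /negbT; rewrite -ltnNge => lt_p.
by apply/set0Pn; exists p; rewrite inE pend_p.
Qed.

Lemma furthest_dest_ge s B : (s <= furthest_dest s B)%N.
Proof. by have : (s <= furthest_dest s B)%O by exact: bigmax_ge_id. Qed.

Lemma furthest_orig_ge s B : (s <= furthest_orig s B)%N.
Proof. by have : (s <= furthest_orig s B)%O by exact: bigmax_ge_id. Qed.

(** Origin and destination differ, so an upward passenger ends strictly above [ord0]. After an
    upward sweep the server is thus away from the origin. *)
Lemma furthest_dest_neq0 s t U B :
  B \subset pending_up s t U -> B != set0 -> furthest_dest s B != ord0.
Proof.
move=> /subsetP subB /set0Pn[p pB].
have := subB _ pB; rewrite !inE => /andP[_ /andP[_ le_p]].
have lt_p : (orig (req p) < dest (req p))%N.
  by rewrite ltn_neqAle le_p andbT; exact: orig_neq_dest.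
have le_d : (dest (req p) <= furthest_dest s B)%N.
  by have : (dest (req p) <= furthest_dest s B)%O by exact: le_bigmax_cond.
by rewrite -val_eqE /= -lt0n (leq_trans _ le_d) // (leq_ltn_trans _ lt_p).
Qed.

(* The last term is the cost of finishing the round in progress, which has
   been paid for by a served passenger unless the server is at v_0. *)
Lemma main_run_length_le s t U w : main_run ell Cap s t U w ->
  tour_length ell (s :: w)
    <= 2 * L * #|U|%:R + (if s == ord0 then 0 else 2 * L - position ell s).
Proof.
have L0 : 0 <= L := line_length_ge0 ell_ge1.
(* A nonempty batch releases a budget of [2 * L]; an arbitrary one, as in [keep], at least costs
   nothing. *)
have serve A B U' : A \subset U' -> A != set0 -> batch Cap A B ->
    2 * L * #|U' :\: B|%:R + 2 * L <= 2 * L * #|U'|%:R.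
  move=> subA A0 batchB.
  rewrite -{2}[2 * L]mulr1 -mulrDr natr1 ler_wpM2l ?mulr_ge0 // ler_nat.
  exact: card_setD_batch_lt batchB.
have keep B U' : 2 * L * #|U' :\: B|%:R <= 2 * L * #|U'|%:R.
  by rewrite ler_wpM2l ?mulr_ge0 // ler_nat subset_leq_card // subsetDl.
elim=> {s t U w}.
- by move=> t; rewrite tour_length1 eqxx cards0 mulr0 addr0.
- move=> s t U w _ /negPf s0 _; rewrite eqxx addr0 s0 tour_length_cons2.
  rewrite dist_origin //; have := position_le_line ell_ge1 s; rewrite -/L; lra.
- by [].
- move=> s t U B w up0 batchB _.
  have [subB _ _] := batchB.
  have B0 := batch_neq0 up0 batchB.
  rewrite (negPf (furthest_dest_neq0 subB B0)) tour_length_cons2.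
  rewrite dist_le ?furthest_dest_ge //.
  (* The distance driven plus the new last term is exactly [2 * L - position ell s]: the old last
     term covers it away from [ord0], a served passenger at [ord0]. *)
  have := serve _ _ _ (pending_up_sub _ _ _) up0 batchB.
  have := keep B U.
  by case: eqP => [->|_]; rewrite ?position0; lra.
- move=> s t U B w pend0 up0 batchB _; rewrite eqxx addr0 !tour_length_cons2.
  rewrite dist_origin // dist_le ?furthest_orig_ge //.
  have := position_le_line ell_ge1 (furthest_orig s B); rewrite -/L.
  have := keep B U.
  (* Away from [ord0] the old last term pays for the sweep, even if the batch is empty; at [ord0]
     somebody is served. *)
  case: eqP => [s0|_]; last lra.
  move: up0; rewrite s0 position0 => /(pending_down_neq0 pend0) down0.
  have := serve _ _ _ (pending_down_sub _ _) down0 batchB.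
  lra.
Qed.

(** Induction on the number of unserved passengers. The moves that serve nobody, waiting and an
    empty downward sweep, are followed by one that does. *)
Lemma main_run_exists s t U : exists w, main_run ell Cap s t U w.
Proof.
have [k] := ubnP #|U|; elim: k s t U => // k IHk s t U; rewrite ltnS => leU.
have up s' t' : pending_up s' t' U != set0 -> exists w, main_run ell Cap s' t' U w.
  move=> up0; have [B batchB] := batch_exists (pending_up s' t' U).
  have ltD := card_setD_batch_lt (pending_up_sub _ _ _) up0 batchB.
  have [w run] := IHk (furthest_dest s' B)
    (t' + dist ell s' (furthest_dest s' B)) _ (leq_trans ltD leU).
  by eexists; exact: main_up up0 batchB run.
have down s' t' : pending_down t' U != set0 -> exists w, main_run ell Cap s' t' U w.
  move=> down0; have [/up//|] := boolP (pending_up s' t' U != set0).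
  move=> /negPn/eqP up0; have [B batchB] := batch_exists (pending_down t' U).
  have ltD := card_setD_batch_lt (pending_down_sub _ _) down0 batchB.
  have pend0 : pending t' U != set0.
    have /set0Pn[p] := down0; rewrite inE => /andP[pend_p _].
    by apply/set0Pn; exists p.
  have [w run] := IHk ord0 (t' + dist ell s' (furthest_orig s' B)
    + dist ell (furthest_orig s' B) ord0) _ (leq_trans ltD leU).
  by eexists; exact: main_down pend0 up0 batchB run.
have origin t' : pending t' U != set0 -> exists w, main_run ell Cap ord0 t' U w.
  move=> pend0; have [/up//|] := boolP (pending_up ord0 t' U != set0).
  by move=> /negPn/eqP/(pending_down_neq0 pend0)/down.
have busy t' : pending t' U != set0 -> exists w, main_run ell Cap s t' U w.
  move=> pend0; have [/up//|/negPn/eqP up0] := boolP (pending_up s t' U != set0).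
  have [/down//|/negPn/eqP down0] := boolP (pending_down t' U != set0).
  have batch0 : batch Cap (pending_down t' U) set0.
    by rewrite down0; exact: batch_set0.
  (* Arrival time at [ord0] after a downward sweep without passengers. Whoever was pending at [t]
     still is, and can be served from there. *)
  set t'' := t' + dist ell s (furthest_orig s (set0 : {set passenger sigma}))
    + dist ell (furthest_orig s (set0 : {set passenger sigma})) ord0.
  have [|w run] := origin t''.
    have /set0Pn[p] := pend0; rewrite inE => /andP[pU rel_p].
    apply/set0Pn; exists p; rewrite inE pU /=; apply: le_trans rel_p _.
    by rewrite /t'' -addrA lerDl addr_ge0 ?dist_ge0.
  by eexists; apply: main_down pend0 up0 batch0 _; rewrite setD0; exact: run.
have [/busy//|/negPn/eqP pend0] := boolP (pending t U != set0).
have [U0|/set0Pn[p0 p0U]] := eqVneq U set0.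
  move: pend0; rewrite U0 => pend0; have [->|s0] := eqVneq s ord0.
    by exists [::]; exact: main_done.
  by exists [:: ord0]; apply: main_home => //; exact: main_done.
(* Wait for the earliest release, which makes [p] pending. *)
case: (arg_minP (fun p => release (req p)) p0U) => p pU min_p.
have [|w run] := busy (release (req p)).
  by apply/set0Pn; exists p; rewrite inE lexx andbT; exact: pU.
by exists w; exact: main_wait pend0 pU min_p run.
Qed.

End Passengers.

Theorem theorem5 (R : realType) (n : nat) (ell : 'I_n -> R)
    (ell_ge1 : forall e : 'I_n, 1 <= ell e)
    (Cap : nat) (Cap_gt0 : (0 < Cap)%N) :
  competitive ell Cap (MAIN ell Cap) (2 * Cap%:R * line_length ell).
Proof.
move=> sigma sigma_valid; split.
  have [w run] := main_run_exists ell Cap_gt0 ord0 0 [set: passenger sigma].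
  by exists (ord0 :: w), w.
move=> _ [w run ->].
have := main_run_length_le ell_ge1 Cap_gt0 sigma_valid run.
(* The run starts at [ord0], so no round is in progress and the last term vanishes. *)
rewrite eqxx addr0 cardsT => /le_trans; apply.
rewrite [2 * Cap%:R * _]mulrAC -[leRHS]mulrA ler_wpM2l //.
  by rewrite mulr_ge0 // line_length_ge0.
exact: card_passengers_le_OPT.
Qed.
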